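(* Let $p\ge2$ and $\mathcal F\in(\mathbb R^n\otimes\mathrm S^p\mathbb R^n)\setminus\{0\}$, not of the form $a\otimes^{p+1}u$ with $\|u\|_2=1$, $a\ne0$. Let $\tilde f_k:=\|\mathcal F^{\circ k}\|_\sigma^{(p-1)/(p^k-1)}$. Then $\tilde f_k\le\|\mathcal F\|_\sigma$ for all $k\in\mathbb N$; $\|\mathcal F^{\circ(k+l)}\|_\sigma\le\|\mathcal F^{\circ k}\|_\sigma\|\mathcal F^{\circ l}\|_\sigma^{p^k}$ for all $k,l\in\mathbb N$; for each fixed $m\in\mathbb N$ the sequence $(\tilde f_{m2^l})_{l\ge0}$ is nonincreasing; the limit $\rho_3(\mathcal F):=\lim_{k\to\infty}\tilde f_k$ exists; and $\rho_3(\mathcal F)\le\rho_2(\mathcal F)$. Moreover, for $k,l\in\mathbb N$, equality holds in the second inequality iff either $\mathcal F^{\circ l}=0$, or there exists $x^\star\in\mathbb R^n$ with $\|x^\star\|_2=1$, $\|\mathbf F^{\circ l}(x^\star)\|_2=\|\mathcal F^{\circ l}\|_\sigma$, and $\|\mathbf F^{\circ k}(y)\|_2=\|\mathcal F^{\circ k}\|_\sigma$ for $y=\|\mathcal F^{\circ l}\|_\sigma^{-1}\mathbf F^{\circ l}(x^\star)$.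
   Context: Tensors carry the entrywise inner product, the Hilbert–Schmidt norm $\|\cdot\|_{HS}$ and the spectral norm $\|\mathcal T\|_\sigma=\max|\langle\mathcal T,x_1\otimes\cdots\otimes x_d\rangle|$ over unit vectors. $\mathbb R^n\otimes\mathrm S^p\mathbb R^n$ denotes tensors $\mathcal F=[f_{i_1,\dots,i_{p+1}}]$ in $\mathbb R^n\otimes(\bigotimes^p\mathbb R^n)$ symmetric in the last $p$ indices; it corresponds bijectively to the homogeneous polynomial map $\mathbf F:\mathbb R^n\to\mathbb R^n$ of degree $p$, $\mathbf F(x)=\mathcal F\times\otimes^px$, i.e. $F_i(x)=\sum_{i_2,\dots,i_{p+1}}f_{i,i_2,\dots,i_{p+1}}x_{i_2}\cdots x_{i_{p+1}}$; one has $\|\mathcal F\|_\sigma=\max_{x\ne0}\|\mathbf F(x)\|_2/\|x\|_2^p$. The composition $\mathcal G\circ\mathcal F$ of $\mathcal F\in\mathbb R^m\otimes\mathrm S^p\mathbb R^n$, $\mathcal G\in\mathbb R^l\otimes\mathrm S^q\mathbb R^m$ is the unique element of $\mathbb R^l\otimes\mathrm S^{pq}\mathbb R^n$ whose map is $\mathbf G\circ\mathbf F$; $\mathcal F^{\circ k}$ is the $k$-fold composition, corresponding to the iterate $\mathbf F^{\circ k}$. $\rho_2(\mathcal F):=\lim_{k\to\infty}\|\mathcal F^{\circ k}\|_{HS}^{(p-1)/(p^k-1)}$ (this limit exists). *)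

(* Defs.v *)
From HB Require Import structures.
From mathcomp Require Import all_boot all_order all_algebra all_fingroup.
From mathcomp Require Import all_classical all_reals all_analysis.
Set Implicit Arguments. Unset Strict Implicit. Unset Printing Implicit Defensive.
Import Order.TTheory GRing.Theory Num.Theory numFieldNormedType.Exports.
Local Open Scope ring_scope.
Local Open Scope classical_set_scope.

(* A tensor in R^n (x) (R^n)^{(x) d} is encoded as a function
   F i s, where i is the first index and s (a d-tuple, seen as a seq) is the
   list of the remaining d indices.  Only values on d-tuples are meaningful. *)
Definition tensor (R : realType) (n : nat) := 'I_n -> seq 'I_n -> R.

Section Tensors.
Variables (R : realType) (n : nat).
Implicit Types (F G : tensor R n) (x : 'I_n -> R).

Definition tsym (d : nat) F :=
  forall (i : 'I_n) (s t : d.-tuple 'I_n), perm_eq s t -> F i s = F i t.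

Definition teq (d : nat) F G := forall (i : 'I_n) (t : d.-tuple 'I_n), F i t = G i t.
Definition tzero (d : nat) F := forall (i : 'I_n) (t : d.-tuple 'I_n), F i t = 0.

Definition norm2 x : R := Num.sqrt (\sum_(i < n) x i ^+ 2).

Definition polymap (d : nat) F x : 'I_n -> R :=
  fun i => \sum_(t : d.-tuple 'I_n) F i t * \prod_(j <- t) x j.

Definition hsnorm (d : nat) F : R :=
  Num.sqrt (\sum_(i < n) \sum_(t : d.-tuple 'I_n) F i t ^+ 2).

Definition specnorm (d : nat) F : R :=
  sup [set r : R | exists (y : 'I_n -> R) (xs : 'I_d -> 'I_n -> R),
        norm2 y = 1 /\ (forall j, norm2 (xs j) = 1) /\
        r = `| \sum_(i < n) \sum_(t : d.-tuple 'I_n)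
                  F i t * y i * \prod_(j < d) xs j (tnth t j) | ].

Definition symz (d : nat) F : tensor R n :=
  fun i u => (\sum_(v : d.-tuple 'I_n | perm_eq v u) F i v)
             / (#|[pred v : d.-tuple 'I_n | perm_eq v u]|)%:R.

(* composition G o F for G of order q+1 and F of order p+1: the unique
   element of R^n (x) S^{qp} R^n whose map is G o F (a tensor whose map is
   G o F, then symmetrized). *)
Definition tcomp (q p : nat) G F : tensor R n :=
  symz (q * p) (fun i u => \sum_(s : q.-tuple 'I_n)
        G i s * \prod_(j < q) F (tnth s j) (take p (drop (j * p) u))).

Definition tid : tensor R n := fun i u => if u == [:: i] then 1 else 0.

Fixpoint titer (p : nat) F (k : nat) : tensor R n :=
  match k with
  | 0 => tid
  | k'.+1 => tcomp (p ^ k') p (titer p F k') F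
  end.

Definition ftilde (p : nat) F (k : nat) : R :=
  specnorm (p ^ k) (titer p F k) `^ ((p - 1)%:R / (p ^ k - 1)%:R).

Definition rho2 (p : nat) F : R :=
  limn (fun k => hsnorm (p ^ k) (titer p F k) `^ ((p - 1)%:R / (p ^ k - 1)%:R)).

End Tensors.

(* Main.v *)
(** By Banach's theorem the spectral norm of a tensor symmetric in its last
    indices is attained on the diagonal, so [||F||_sigma] is the maximum of
    [|F(x)|] over the unit sphere. Homogeneity then gives
    [|F^k (F^l x)| <= ||F^k|| ||F^l||^(p^k)], with equality exactly when one
    point saturates both steps. It also shows that a symmetric tensor is
    determined by its polynomial map, whence [F^(k+l) = F^k o F^l] as tensors
    and the same inequality for the Hilbert-Schmidt norm, by Cauchy-Schwarz.
    Finally, [A (l+1) <= A 1 * (A l)^p] makes [A l ^ (1 / p^l)] nonincreasing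
    after normalization, so both sequences of roots converge, and
    [||.||_sigma <= ||.||_HS] compares the limits. *)

Require Import Defs.
From HB Require Import structures.
From mathcomp Require Import all_boot all_order all_algebra all_fingroup.
From mathcomp Require Import all_classical all_reals all_analysis.
From mathcomp Require Import ring lra.
Set Implicit Arguments.
Unset Strict Implicit.
Unset Printing Implicit Defensive.
Import Order.TTheory GRing.Theory Num.Theory numFieldNormedType.Exports.
Local Open Scope ring_scope.
Local Open Scope classical_set_scope.

(** * Compact maximization on products, continuity of finite sums and products, Cauchy-Schwarz *)

Lemma prod_EVT_max (R : realType) (I : eqType)
    (A : set (prod_topology (fun _ : I => R)))
    (f : prod_topology (fun _ : I => R) -> R) :
  A !=set0 -> closed A -> (forall x, A x -> forall i, `|x i| <= 1) ->
  continuous f -> exists2 c, A c & forall t, A t -> f t <= f c.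
Proof.
move=> A0 cA bA cf.
have cptA : compact A.
  (* The coordinate bound places [A] in the cube [-1, 1]^I, compact by Tychonoff. *)
  apply: (subclosed_compact cA
    (@tychonoff I (fun=> R) (fun=> `[-1, 1]%classic) _)).
    by move=> i; exact: segment_compact.
  by move=> x Ax i /=; rewrite in_itv/= -ler_norml; exact: bA.
have /(compact_EVT_max A0 cptA)[c /set_mem Ac cmax] : {within A, continuous f}.
  exact: continuous_subspaceT.
by exists c => // t At; apply: cmax; exact: mem_set.
Qed.

Lemma prod_coord_continuous (R : realType) (I : eqType) (i : I) :
  continuous (fun x : prod_topology (fun _ : I => R) => x i : R).
Proof. exact: (@proj_continuous I (fun=> R) i). Qed.

Lemma continuous_sumr (R : realType) (T : topologicalType) (J : finType)
    (f : J -> T -> R) :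
  (forall j, continuous (f j)) -> continuous (fun x => \sum_j f j x).
Proof. by move=> cf; apply: continuous_big => //; exact: add_continuous. Qed.

Lemma continuous_prodr (R : realType) (T : topologicalType) (J : Type)
    (r : seq J) (f : J -> T -> R) :
  (forall j, continuous (f j)) -> continuous (fun x => \prod_(j <- r) f j x).
Proof. by move=> cf; apply: continuous_big => //; exact: mul_continuous. Qed.

Lemma closed_eq_level (R : realType) (T : topologicalType) (f : T -> R) (c : R) :
  continuous f -> closed [set x | f x = c].
Proof.
move=> cf; apply: (@closed_comp _ _ f [set c]); first by move=> x _; exact: cf.
exact: closed_eq.
Qed.

(** The sum of the squares (b x_i - c y_i)^2 equals b (ab - c^2), so b divides out; when b = 0, all
    y_i vanish and c = 0. *)
Lemma cauchy_schwarz (R : realType) (I : finType) (x y : I -> R) :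
  (\sum_i x i * y i) ^+ 2 <= (\sum_i x i ^+ 2) * \sum_i y i ^+ 2.
Proof.
set a := \sum_i x i ^+ 2; set b := \sum_i y i ^+ 2; set c := \sum_i x i * y i.
have b0 : 0 <= b by apply: sumr_ge0 => i _; exact: sqr_ge0.
have : 0 <= \sum_i (b * x i - c * y i) ^+ 2.
  by apply: sumr_ge0 => i _; exact: sqr_ge0.
have -> : \sum_i (b * x i - c * y i) ^+ 2 = b * (a * b - c ^+ 2).
  transitivity (b ^+ 2 * a - 2 * b * c * c + c ^+ 2 * b); last by ring.
  rewrite [X in _ - X]mulr_sumr [X in X - _]mulr_sumr [X in _ + X]mulr_sumr.
  by rewrite -sumrB -big_split/=; apply: eq_bigr => i _; ring.
move: b0; rewrite le_eqVlt => /predU1P[b0 _|b0].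
  have y0 i : y i = 0.
    apply/eqP; rewrite -sqrf_eq0; apply/eqP; move: i (erefl true).
    by apply: psumr_eq0P => // i _; exact: sqr_ge0.
  by rewrite -b0 mulr0 /c big1 ?expr0n// => i _; rewrite y0 mulr0.
by rewrite pmulr_rge0// subr_ge0.
Qed.

Lemma continuous_normr (R : realType) (T : topologicalType) (f : T -> R) :
  continuous f -> continuous (fun x => `|f x|).
Proof.
by move=> cf x; apply: (@cvg_norm _ _ _ _ _ f (f x)); exact: cf.
Qed.

(** * Euclidean vectors *)

Section Dot.
Variables (R : realType) (n : nat).
Implicit Types x y u v w : 'I_n -> R.

Definition dot x y : R := \sum_i x i * y i.

Lemma dotC x y : dot x y = dot y x.
Proof. by apply: eq_bigr => i _; rewrite mulrC. Qed.

Lemma dot_lin (a b : R) u v w :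
  dot (fun k => a * u k + b * v k) w = a * dot u w + b * dot v w.
Proof.
by rewrite /dot !mulr_sumr -big_split/=; apply: eq_bigr => i _; ring.
Qed.

Lemma dot_linr (a b : R) u v w :
  dot w (fun k => a * u k + b * v k) = a * dot w u + b * dot w v.
Proof. by rewrite dotC dot_lin !(dotC w). Qed.

Lemma dotZr (c : R) u w : dot w (fun k => c * u k) = c * dot w u.
Proof. by rewrite /dot mulr_sumr; apply: eq_bigr => i _; ring. Qed.

Lemma dotZ (c : R) u : dot (fun k => c * u k) (fun k => c * u k) = c ^+ 2 * dot u u.
Proof. by rewrite /dot mulr_sumr; apply: eq_bigr => i _; ring. Qed.

Lemma dot_ge0 x : 0 <= dot x x.
Proof. by apply: sumr_ge0 => i _; rewrite -expr2 sqr_ge0. Qed.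

Lemma dot_eq0 x : dot x x = 0 -> x = fun=> 0.
Proof.
move=> x0; apply/funext => i; apply/eqP; rewrite -sqrf_eq0 expr2; apply/eqP.
move: i (erefl true).
by apply: psumr_eq0P => // i _; rewrite -expr2 sqr_ge0.
Qed.

Lemma dotE x : dot x x = \sum_i x i ^+ 2.
Proof. by apply: eq_bigr => i _; rewrite expr2. Qed.

Lemma sqr_norm2 x : norm2 x ^+ 2 = dot x x.
Proof.
rewrite dotE sqr_sqrtr//.
by apply: sumr_ge0 => i _; exact: sqr_ge0.
Qed.

Lemma norm2_ge0 x : 0 <= norm2 x.
Proof. exact: sqrtr_ge0. Qed.

Lemma norm2_eq1 x : norm2 x = 1 <-> dot x x = 1.
Proof.
rewrite -sqr_norm2; split=> [->|/eqP]; first by rewrite expr1n.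
by rewrite sqrp_eq1 ?norm2_ge0// => /eqP.
Qed.

Lemma norm2Z (c : R) u : 0 <= c -> norm2 (fun k => c * u k) = c * norm2 u.
Proof.
move=> c0; apply/eqP; rewrite -(@eqrXn2 _ 2) ?mulr_ge0 ?norm2_ge0//.
by rewrite exprMn !sqr_norm2 dotZ.
Qed.

Lemma norm2_cauchy_schwarz x y : `|dot x y| <= norm2 x * norm2 y.
Proof.
rewrite -(@ler_pXn2r _ 2) ?nnegrE ?mulr_ge0 ?norm2_ge0//.
rewrite real_normK ?num_real// exprMn !sqr_norm2 !dotE.
exact: cauchy_schwarz.
Qed.

Lemma norm2_0 : norm2 (fun _ : 'I_n => 0) = 0 :> R.
Proof. by rewrite /norm2 big1 ?sqrtr0// => i _; rewrite expr0n. Qed.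

Lemma unit_vector : (0 < n)%N -> exists e : 'I_n -> R, dot e e = 1.
Proof.
move=> n0; pose i0 := Ordinal n0; exists (fun k => (k == i0)%:R).
rewrite /dot (bigD1 i0)// eqxx mulr1 big1 ?[LHS]addr0// => i /negbTE ->.
by rewrite mul0r.
Qed.

Lemma unit_decomp : (0 < n)%N -> forall u,
  exists2 e : 'I_n -> R, dot e e = 1 & u = fun k => norm2 u * e k.
Proof.
move=> n0 u; have [u0|u0] := eqVneq (norm2 u) 0.
  have [e e1] := unit_vector n0; exists e => //.
  have /dot_eq0 -> : dot u u = 0 by rewrite -sqr_norm2 u0 expr0n.
  by apply/funext => k; rewrite norm2_0 mul0r.
exists (fun k => (norm2 u)^-1 * u k); last by apply/funext => k; rewrite mulVKf.
by rewrite dotZ -sqr_norm2 exprVn mulVf// expf_neq0.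
Qed.

(* Polarization: [B s s - B r r = 4 B x1 x2] for [s = x1 + x2], [r = x1 - x2],
   and [|s|^2 + |r|^2 = 4] by the parallelogram law. *)
Lemma bilinear_max_midpoint (B : ('I_n -> R) -> ('I_n -> R) -> R) (sigma : R)
    (x1 x2 : 'I_n -> R) (s := fun k => 1 * x1 k + 1 * x2 k) :
  (0 < n)%N ->
  (forall a b u v w, B (fun k => a * u k + b * v k) w = a * B u w + b * B v w) ->
  (forall u v, B u v = B v u) ->
  (forall u v, dot u u = 1 -> dot v v = 1 -> `|B u v| <= sigma) ->
  dot x1 x1 = 1 -> dot x2 x2 = 1 -> `|B x1 x2| = sigma ->
  sigma * dot s s <= `|B s s|.
Proof.
move=> n0 Blin Bsym Bub x11 x21 Bx.
have BlinR a b u v w :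
    B w (fun k => a * u k + b * v k) = a * B w u + b * B w v.
  by rewrite Bsym Blin !(Bsym w).
have Bdiag u : `|B u u| <= sigma * dot u u.
  have [e e1 ->] := unit_decomp n0 u; set c := norm2 u.
  (* [Blin] speaks of two-term combinations, so a multiple gets a second term with coefficient 0. *)
  have -> : (fun k => c * e k) = (fun k => c * e k + 0 * e k).
    by apply/funext => k; rewrite mul0r addr0.
  rewrite Blin !BlinR dot_lin !dot_linr !mul0r !addr0 e1 mulr1 !normrM.
  rewrite mulrA -[X in X * _]normrM ger0_norm -?expr2 ?sqr_ge0//.
  by rewrite mulrC ler_wpM2r ?sqr_ge0// Bub.
pose r := fun k => 1 * x1 k + (-1) * x2 k.
have sr : B s s = B r r + 4 * B x1 x2.
  by rewrite /s /r !Blin !BlinR (Bsym x2 x1); ring.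
have := Bdiag r.
have -> : dot r r = 4 - dot s s.
  by rewrite /s /r !dot_lin !dot_linr x11 x21 (dotC x2 x1); ring.
have -> : B r r = B s s - 4 * B x1 x2 by rewrite sr addrK.
(* Since |B r r| <= sigma (4 - |s|^2), what remains for |B s s| is at least sigma |s|^2. *)
have : 4 * sigma <= `|B s s| + `|B s s - 4 * B x1 x2|.
  have -> : 4 * sigma = `|B s s + - (B s s - 4 * B x1 x2)|.
    by rewrite opprB addrC subrK normrM Bx ger0_norm.
  by rewrite -(normrN (B s s - 4 * B x1 x2)); exact: ler_normD.
by lra.
Qed.

End Dot.

(** * Banach's theorem on symmetric multilinear forms *)

Section Banach.
Variables (R : realType) (n : nat).
Implicit Types (a : seq 'I_n -> R) (u v w : 'I_n -> R).

Definition mlin d a (xs : 'I_d -> 'I_n -> R) : R :=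
  \sum_(t : d.-tuple 'I_n) a t * \prod_(j < d) xs j (tnth t j).

Definition upd d (xs : 'I_d -> 'I_n -> R) (i : 'I_d) u : 'I_d -> 'I_n -> R :=
  fun j => if j == i then u else xs j.

Lemma mlin_upd d a (xs : 'I_d -> 'I_n -> R) i u :
  mlin a (upd xs i u) = \sum_(t : d.-tuple 'I_n)
    a t * (u (tnth t i) * \prod_(j < d | j != i) xs j (tnth t j)).
Proof.
apply: eq_bigr => t _; congr (_ * _); rewrite (bigD1 i)//= /upd eqxx.
by congr (_ * _); apply: eq_bigr => j /negbTE ->.
Qed.

Lemma mlin_upd_lin d a (xs : 'I_d -> 'I_n -> R) i (b c : R) u v :
  mlin a (upd xs i (fun k => b * u k + c * v k)) =
  b * mlin a (upd xs i u) + c * mlin a (upd xs i v).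
Proof.
rewrite !mlin_upd [b * _]mulr_sumr [c * _]mulr_sumr -big_split/=.
by apply: eq_bigr => t _; ring.
Qed.

(** Permuting the arguments by [s] amounts to permuting every index tuple by the inverse of [s],
    which preserves [a] and only reorders the sum. *)
Lemma mlin_perm d a (xs : 'I_d -> 'I_n -> R) (s : 'S_d) :
  (forall t t' : d.-tuple 'I_n, perm_eq t t' -> a t = a t') ->
  mlin a (fun j => xs (s j)) = mlin a xs.
Proof.
move=> asym; pose h (t : d.-tuple 'I_n) := [tuple tnth t ((s^-1)%g j) | j < d].
have hK : cancel h (fun t => [tuple tnth t (s j) | j < d]).
  by move=> t; apply: eq_from_tnth => j; rewrite !tnth_mktuple permK.
rewrite /mlin [RHS](reindex_inj (can_inj hK)); apply: eq_bigr => t _.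
congr (_ * _).
  by apply: asym; rewrite perm_sym; apply/tuple_permP; exists (s^-1)%g.
rewrite [RHS](reindex_inj (@perm_inj _ s)); apply: eq_bigr => j _.
by rewrite tnth_mktuple permK.
Qed.

(** Uncurried, the families of unit vectors form a closed subset of a cube. After [f] is maximized
    there, [g] is maximized over the closed set of maximizers of [f]. *)
Lemma sphere_lex_max d (f g : ('I_d -> 'I_n -> R) -> R)
    (T := prod_topology (fun _ : 'I_d * 'I_n => R)) :
  (0 < n)%N ->
  continuous (fun X : T => f (fun j k => X (j, k))) ->
  continuous (fun X : T => g (fun j k => X (j, k))) ->
  exists xs : 'I_d -> 'I_n -> R, [/\ forall j, dot (xs j) (xs j) = 1,
    forall ys, (forall j, dot (ys j) (ys j) = 1) -> f ys <= f xs &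
    forall ys, (forall j, dot (ys j) (ys j) = 1) -> f ys = f xs ->
      g ys <= g xs].
Proof.
move=> n0 cf cg.
pose cur (X : T) : 'I_d -> 'I_n -> R := fun j k => X (j, k).
pose unc (xs : 'I_d -> 'I_n -> R) : T := fun jk => xs jk.1 jk.2.
have uncK xs : cur (unc xs) = xs by [].
pose S : set T := [set X | forall j, dot (cur X j) (cur X j) = 1].
have cS : closed S.
  have -> : S = \bigcap_j [set X | dot (cur X j) (cur X j) = 1].
    by apply/seteqP; split => X /= h j; [move=> _|]; exact: h.
  apply: closed_bigI => j _; apply: closed_eq_level.
  apply: continuous_sumr => k X.
  by apply: (@continuousM R T); exact: (@prod_coord_continuous R _ (j, k) X).
have bS X : S X -> forall jk, `|X jk| <= 1.
  move=> SX [j k]; rewrite -(@ler_pXn2r _ 2) ?nnegrE// expr1n.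
  rewrite real_normK ?num_real// -(SX j) dotE (bigD1 k)//= lerDl.
  by apply: sumr_ge0 => i _; exact: sqr_ge0.
have [e e1] := unit_vector R n0.
have S0 : S !=set0 by exists (unc (fun=> e)) => j; exact: e1.
have [X SX Xmax] := prod_EVT_max S0 cS bS cf.
pose M := S `&` [set Y | f (cur Y) = f (cur X)].
have cM : closed M by apply: closedI => //; exact: closed_eq_level.
have bM Y : M Y -> forall jk, `|Y jk| <= 1 by move=> [/bS].
have M0 : M !=set0 by exists X.
have [Y [SY fY] Ymax] := prod_EVT_max M0 cM bM cg.
exists (cur Y); split => // ys ys1.
  by rewrite fY; apply: (Xmax (unc ys)).
by rewrite fY => fys; apply: (Ymax (unc ys)).
Qed.

Lemma sum_upd d (xs : 'I_d -> 'I_n -> R) i u k :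
  \sum_j upd xs i u j k = \sum_j xs j k - xs i k + u k.
Proof.
rewrite (bigD1 i)//= [in RHS](bigD1 i)//= /upd eqxx.
rewrite (eq_bigr (fun j => xs j k)) => [|j /negbTE -> //]; ring.
Qed.

Lemma mlin_continuous d a : continuous
  (fun X : prod_topology (fun _ : 'I_d * 'I_n => R) => mlin a (fun j k => X (j, k))).
Proof.
apply: continuous_sumr => t X; apply: continuousM; first exact: cst_continuous.
by apply: continuous_prodr => j; exact: prod_coord_continuous.
Qed.

(* Among the maximizers of [|mlin a|] pick one with the longest sum
   [Z = x_1 + ... + x_d]. Flipping the sign of [x_i] keeps a maximizer, hence
   [<x_i, Z> >= 1]; replacing [x_i, x_j] by their normalized midpoint also keeps
   a maximizer and would lengthen [Z] if [x_i] and [x_j] were distinct. *)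
Theorem banach_diagonal d a :
  (0 < n)%N ->
  (forall t t' : d.-tuple 'I_n, perm_eq t t' -> a t = a t') ->
  exists2 x, dot x x = 1 & forall xs : 'I_d -> 'I_n -> R,
    (forall j, dot (xs j) (xs j) = 1) ->
    `|mlin a xs| <= `|mlin a (fun _ : 'I_d => x)|.
Proof.
move=> n0 asym.
pose Z (xs : 'I_d -> 'I_n -> R) := fun k => \sum_j xs j k.
have [||xs [xs1 xsmax Zmax]] := @sphere_lex_max d (fun xs => `|mlin a xs|)
    (fun xs => dot (Z xs) (Z xs)) n0.
- by apply: continuous_normr; exact: mlin_continuous.
- apply: continuous_sumr => k X.
  by apply: continuousM; apply: continuous_sumr => j;
    exact: prod_coord_continuous.
have upd1 i u ys : (forall j, dot (ys j) (ys j) = 1) -> dot u u = 1 ->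
    forall j : 'I_d, dot (upd ys i u j) (upd ys i u j) = 1.
  by move=> ys1 u1 j; rewrite /upd; case: ifP.
have xZ i : 1 <= dot (xs i) (Z xs).
  pose u := fun k => (-1) * xs i k + 0 * xs i k.
  have u1 : dot u u = 1 by rewrite dot_lin !dot_linr xs1; ring.
  have mu : `|mlin a (upd xs i u)| = `|mlin a xs|.
    rewrite mlin_upd_lin mul0r addr0 mulN1r normrN; congr `|mlin a _|.
    by apply/funext => j; rewrite /upd; case: eqP => // ->.
  (* The flip turns Z into Z - 2 x_i, and |Z - 2 x_i|^2 <= |Z|^2 expands to <x_i, Z> >= 1. *)
  have := Zmax _ (upd1 i u xs xs1 u1) mu.
  have -> : Z (upd xs i u) = fun k => 1 * Z xs k + (-2) * xs i k.
    by apply/funext => k; rewrite /Z sum_upd /u; ring.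
  by rewrite dot_lin !dot_linr xs1 (dotC (Z xs)); lra.
have xsE i j : xs i = xs j.
  apply: contrapT => /eqP xij.
  have ij : i != j by apply: contraNneq xij => ->.
  pose B u v := mlin a (upd (upd xs i u) j v).
  have updC u v : upd (upd xs i u) j v = upd (upd xs j v) i u.
    apply/funext => k; rewrite /upd; case: (eqVneq k i) => [->|//].
    by rewrite (negbTE ij).
  have Bsym u v : B u v = B v u.
    rewrite /B -(@mlin_perm d a _ (tperm i j) asym); congr mlin.
    apply/funext => k; rewrite /upd; case: tpermP => [->|->|].
    - by rewrite eqxx (negbTE ij) eqxx.
    - by rewrite (negbTE ij) !eqxx.
    - by move=> /eqP/negbTE -> /eqP/negbTE ->.
  have Blin b c u v w :
      B (fun k => b * u k + c * v k) w = b * B u w + c * B v w.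
    by rewrite /B !updC mlin_upd_lin.
  have Bub u v : dot u u = 1 -> dot v v = 1 -> `|B u v| <= `|mlin a xs|.
    by move=> u1 v1; apply: xsmax; apply: (upd1 _ _ _ (upd1 _ _ _ xs1 u1)).
  have Bxs : `|B (xs i) (xs j)| = `|mlin a xs|.
    congr `|mlin a _|; apply/funext => k; rewrite /upd.
    by case: eqP => [->//|_]; case: eqP => [->|].
  have := bilinear_max_midpoint n0 Blin Bsym Bub (xs1 i) (xs1 j) Bxs.
  set s := (fun k => _) => Bs.
  pose N := norm2 s.
  have N2 : N ^+ 2 = dot s s by exact: sqr_norm2.
  have sZ : 2 <= dot s (Z xs).
    by rewrite dot_lin; have := xZ i; have := xZ j; lra.
  have N0 : 0 < N.
    rewrite lt_neqAle norm2_ge0 andbT; apply/negP => /eqP N0.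
    move: sZ; have /dot_eq0 -> : dot s s = 0 by rewrite -N2 -N0 expr0n.
    by rewrite /dot big1 ?ler0n// => [|k _]; [lra|rewrite mul0r].
  (* For r = x_i - x_j, nonzero, the parallelogram law |r|^2 + N^2 = 4 gives N < 2. *)
  have Nlt2 : N < 2.
    rewrite -(@ltr_pXn2r _ 2) ?nnegrE ?(ltW N0)// N2.
    pose r := fun k => 1 * xs i k + (-1) * xs j k.
    have : 0 < dot r r.
      rewrite lt_neqAle dot_ge0 andbT; apply: contraNneq xij => /esym/dot_eq0 r0.
      apply/eqP/funext => k; move/(congr1 (@^~ k)): r0; rewrite /r; lra.
    by rewrite /r /s !dot_lin !dot_linr !xs1 (dotC (xs j)); lra.
  pose w := fun k => N^-1 * s k.
  have w1 : dot w w = 1 by rewrite dotZ -N2 exprVn mulVf// expf_neq0// gt_eqF.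
  have Bws v : B w v = N^-1 * B s v.
    rewrite -[RHS]addr0 -[X in _ + X](mul0r (B s v)) -Blin; congr B.
    by apply/funext => k; rewrite mul0r addr0.
  (* By the midpoint bound |B s s| is at least N^2 times the maximum, so w in both slots attains
     it. *)
  have Bw : `|B w w| = `|mlin a xs|.
    apply/eqP; rewrite eq_le Bub//=.
    rewrite Bws Bsym Bws mulrA normrM.
    rewrite ger0_norm ?mulr_ge0 ?invr_ge0 ?(ltW N0)//.
    rewrite -invfM [leRHS]mulrC ler_pdivlMr ?mulr_gt0//.
    by rewrite -expr2 N2.
  have uw1 : forall k, dot (upd (upd xs i w) j w k) (upd (upd xs i w) j w k) = 1.
    exact: (upd1 _ _ _ (upd1 _ _ _ xs1 w1)).
  have := Zmax _ uw1 Bw.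
  (* Putting w in slots i and j adds 2 w - s = (2 / N - 1) s to Z. *)
  pose mu := 2 / N - 1.
  have mu0 : 0 < mu by rewrite subr_gt0 ltr_pdivlMr// mul1r.
  have -> : Z (upd (upd xs i w) j w) = fun k => 1 * Z xs k + mu * s k.
    apply/funext => k; rewrite /Z !sum_upd /upd eq_sym (negbTE ij) /w /s /mu; ring.
  rewrite (dot_lin 1 mu (Z xs) s) !(dot_linr 1 mu (Z xs) s) (dotC (Z xs) s) => h.
  (* |Z + mu s|^2 exceeds |Z|^2 by 2 mu <s, Z> + mu^2 |s|^2 >= 4 mu > 0, against the choice of
     [xs]. *)
  have h1 : 2 * mu <= mu * dot s (Z xs) by rewrite mulrC ler_pM2l.
  have h2 : 0 <= mu * (mu * dot s s) by rewrite !mulr_ge0 ?dot_ge0 ?ltW.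
  by lra.
have [x x1 xsx] : exists2 x, dot x x = 1 & xs = fun=> x.
  case: (posnP d) => [d0|d0].
    have [e e1] := unit_vector R n0; exists e => //; apply/funext => j.
    by have := ltn_ord j; rewrite [X in (_ < X)%N]d0.
  by exists (xs (Ordinal d0)) => //; apply/funext => j; exact: xsE.
by exists x => // ys ys1; rewrite -xsx; exact: xsmax.
Qed.

End Banach.

(** * Spectral norm and polynomial maps *)

Section SpectralNorm.
Variables (R : realType) (n : nat).
Implicit Types (F G : tensor R n) (x y : 'I_n -> R).

(** Pairing the first index with y leaves a scalar form, to which Banach's theorem applies. *)
Definition contract F y : seq 'I_n -> R := fun s => \sum_i y i * F i s.

Lemma contract_mlin d F y (xs : 'I_d -> 'I_n -> R) :
  \sum_(i < n) \sum_(t : d.-tuple 'I_n)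
    F i t * y i * \prod_(j < d) xs j (tnth t j) = mlin (contract F y) xs.
Proof.
rewrite exchange_big/=; apply: eq_bigr => t _; rewrite mulr_suml.
by apply: eq_bigr => i _; rewrite (mulrC (F i t)).
Qed.

Lemma contract_diag d F y x :
  mlin (contract F y) (fun _ : 'I_d => x) = dot y (polymap d F x).
Proof.
rewrite -contract_mlin; apply: eq_bigr => i _; rewrite /polymap mulr_sumr.
by apply: eq_bigr => t _; rewrite big_tuple; ring.
Qed.

Lemma contract_sym d F y : tsym d F ->
  forall t t' : d.-tuple 'I_n, perm_eq t t' -> contract F y t = contract F y t'.
Proof. by move=> Fs t t' tt'; apply: eq_bigr => i _; rewrite (Fs i t t'). Qed.

Lemma polymap_continuous d F i : continuous
  (fun X : prod_topology (fun _ : 'I_1 * 'I_n => R) =>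
     polymap d F (fun k => X (ord0, k)) i).
Proof.
apply: continuous_sumr => t X; apply: continuousM; first exact: cst_continuous.
by apply: continuous_prodr => j; exact: prod_coord_continuous.
Qed.

(** For fixed y, Banach's theorem moves the arguments to the diagonal, where the form is <y, F(z)>
    and Cauchy-Schwarz applies. The uniform bound is kept for reuse at arbitrary unit arguments. *)
Lemma specnorm_polymap d F : (0 < n)%N -> tsym d F ->
  exists2 x, dot x x = 1 & specnorm d F = norm2 (polymap d F x) /\
    forall y (xs : 'I_d -> 'I_n -> R), dot y y = 1 ->
      (forall j, dot (xs j) (xs j) = 1) ->
      `|mlin (contract F y) xs| <= specnorm d F.
Proof.
move=> n0 Fs.
(* A single sphere is a family of length 1; the squared norm is polynomial, hence continuous. *)
pose sq (xs : 'I_1 -> 'I_n -> R) := dot (polymap d F (xs ord0)) (polymap d F (xs ord0)).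
have [||xs [xs1 xsmax _]] := @sphere_lex_max R n 1 sq (fun=> 0) n0.
- by apply: continuous_sumr => i X; apply: continuousM; exact: polymap_continuous.
- by move=> X; exact: cst_continuous.
set x := xs ord0 in xsmax; have x1 : dot x x = 1 by exact: xs1.
have xmax y : dot y y = 1 -> norm2 (polymap d F y) <= norm2 (polymap d F x).
  move=> y1; rewrite -(@ler_pXn2r _ 2) ?nnegrE ?norm2_ge0// !sqr_norm2.
  exact: (xsmax (fun=> y)).
have ub y (zs : 'I_d -> 'I_n -> R) : dot y y = 1 ->
    (forall j, dot (zs j) (zs j) = 1) ->
    `|mlin (contract F y) zs| <= norm2 (polymap d F x).
  move=> y1 zs1.
  have [z z1 zmax] := banach_diagonal n0 (contract_sym y Fs).
  apply: le_trans (zmax _ zs1) _; rewrite contract_diag.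
  apply: le_trans (norm2_cauchy_schwarz _ _) _.
  by have /norm2_eq1 -> := y1; rewrite mul1r xmax.
suff sE : specnorm d F = norm2 (polymap d F x).
  by exists x => //; split=> //; rewrite sE.
(* The direction y of F(x) gives <y, F(x)> = |F(x)|, so the bound is reached. *)
have [y y1 yF] := unit_decomp n0 (polymap d F x).
apply/eqP; rewrite eq_le; apply/andP; split.
  apply: ge_sup.
    eexists; exists y, (fun=> x); split; first exact/norm2_eq1.
    by split; first by move=> _; exact/norm2_eq1.
  move=> r [z [zs [/norm2_eq1 z1 [zs1 ->]]]]; rewrite contract_mlin.
  by apply: ub => // j; exact/norm2_eq1.
apply: ub_le_sup.
  exists (norm2 (polymap d F x)) => r [z [zs [/norm2_eq1 z1 [zs1 ->]]]].
  by rewrite contract_mlin; apply: ub => // j; exact/norm2_eq1.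
exists y, (fun=> x); split; first exact/norm2_eq1.
split; first by move=> _; exact/norm2_eq1.
rewrite (contract_mlin F y (fun _ : 'I_d => x)) contract_diag {2}yF.
set N := norm2 (polymap d F x).
by rewrite dotZr y1 mulr1 ger0_norm// norm2_ge0.
Qed.

Lemma specnorm_attained d F : (0 < n)%N -> tsym d F ->
  exists2 x, dot x x = 1 & specnorm d F = norm2 (polymap d F x).
Proof. by move=> n0 /(specnorm_polymap n0)[x x1 []]; exists x. Qed.

Lemma specnorm_ge0 d F : (0 < n)%N -> tsym d F -> 0 <= specnorm d F.
Proof. by move=> n0 /(specnorm_attained n0)[x _ ->]; exact: norm2_ge0. Qed.

Lemma polymapZ d F (c : R) x i :
  polymap d F (fun k => c * x k) i = c ^+ d * polymap d F x i.
Proof.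
rewrite /polymap mulr_sumr; apply: eq_bigr => t _.
by rewrite !big_tuple big_split/= prodr_const card_ord; ring.
Qed.

Lemma norm2_polymap_le d F x : (0 < n)%N -> tsym d F ->
  norm2 (polymap d F x) <= specnorm d F * norm2 x ^+ d.
Proof.
move=> n0 Fs; have [e e1 xe] := unit_decomp n0 x.
have -> : polymap d F x = fun i => norm2 x ^+ d * polymap d F e i.
  by rewrite {1}xe; apply/funext => i; rewrite polymapZ.
rewrite norm2Z ?exprn_ge0 ?norm2_ge0// mulrC ler_wpM2r ?exprn_ge0 ?norm2_ge0//.
have [z _ [_ ub]] := specnorm_polymap n0 Fs.
have [y y1 yF] := unit_decomp n0 (polymap d F e).
have := ub y (fun=> e) y1 (fun=> e1); rewrite contract_diag {1}yF.
set N := norm2 _.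
by rewrite dotZr y1 mulr1 ger0_norm// norm2_ge0.
Qed.

(** At standard basis vectors the form reduces to a single entry of F, which the uniform bound
    forces to be 0. *)
Lemma specnorm0_tzero d F : tsym d F -> specnorm d F = 0 -> tzero d F.
Proof.
move=> Fs F0 i t; have n0 : (0 < n)%N by exact: leq_ltn_trans (ltn_ord i).
have [z _ [_ ub]] := specnorm_polymap n0 Fs.
pose e (j k : 'I_n) : R := (k == j)%:R.
have e1 j : dot (e j) (e j) = 1.
  rewrite /dot (bigD1 j)//= /e eqxx mulr1 big1 ?addr0// => k /negbTE ->.
  by rewrite mul0r.
have := ub (e i) (fun j => e (tnth t j)) (e1 i) (fun j => e1 _).
rewrite F0 normr_le0 => /eqP <-; rewrite /mlin (bigD1 t)//=.
rewrite [X in _ + X]big1 ?addr0 => [|u ut].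
  rewrite big1 ?mulr1 => [|j _]; last by rewrite /e eqxx.
  rewrite /contract (bigD1 i)//= /e eqxx mul1r big1 ?addr0// => k /negbTE ->.
  by rewrite mul0r.
have /existsP[j tuj] : [exists j, tnth u j != tnth t j].
  rewrite -negb_forall; apply: contra ut => /forallP ut.
  by apply/eqP/eq_from_tnth => j; exact/eqP.
by rewrite [X in _ * X](bigD1 j)//= /e (negbTE tuj) mul0r mulr0.
Qed.

Lemma polymap_tzero d F : tzero d F -> polymap d F = fun _ _ => 0.
Proof.
move=> F0; apply/funext => x; apply/funext => i.
by rewrite /polymap big1// => t _; rewrite F0 mul0r.
Qed.

Lemma tzero_specnorm0 d F : (0 < n)%N -> tsym d F -> tzero d F ->
  specnorm d F = 0.
Proof.
move=> n0 Fs F0; have [x _ ->] := specnorm_attained n0 Fs.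
by rewrite polymap_tzero// norm2_0.
Qed.

(** The difference is symmetric with zero map, so its spectral norm, attained on the diagonal, is
    0. *)
Lemma polymap_inj d F G : tsym d F -> tsym d G ->
  polymap d F = polymap d G -> teq d F G.
Proof.
move=> Fs Gs FG i t; have n0 : (0 < n)%N by exact: leq_ltn_trans (ltn_ord i).
pose D : tensor R n := fun i s => F i s - G i s.
have Ds : tsym d D by move=> j s s' ss'; rewrite /D (Fs _ _ _ ss') (Gs _ _ _ ss').
apply/eqP; rewrite -subr_eq0; apply/eqP; apply: (specnorm0_tzero Ds).
have [x _ ->] := specnorm_attained n0 Ds.
suff -> : polymap d D x = fun=> 0 by exact: norm2_0.
apply/funext => j; apply/eqP.
have /eqP : polymap d F x j = polymap d G x j by rewrite FG.
rewrite -subr_eq0 /polymap -sumrB; congr (_ == _).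
by apply: eq_bigr => s _; rewrite /D mulrBl.
Qed.

Lemma eq_specnorm d F G : teq d F G -> specnorm d F = specnorm d G.
Proof.
move=> FG; congr sup; apply/seteqP; split => r [y [xs [y1 [xs1 ->]]]];
  exists y, xs; split=> //; split=> //; congr `|_|;
  by apply: eq_bigr => i _; apply: eq_bigr => t _; rewrite FG.
Qed.

Lemma eq_hsnorm d F G : teq d F G -> hsnorm d F = hsnorm d G.
Proof.
move=> FG; congr Num.sqrt.
by apply: eq_bigr => i _; apply: eq_bigr => t _; rewrite FG.
Qed.

End SpectralNorm.

(** * Composition of tensors *)

Section Blocks.
Variables (R : realType) (T : finType).

Lemma sum_cat_tuple a b (f : seq T -> R) :
  \sum_(u : (a + b).-tuple T) f u =
  \sum_(s : a.-tuple T) \sum_(t : b.-tuple T) f (s ++ t).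
Proof.
rewrite pair_big/=.
have takeP (u : (a + b).-tuple T) : size (take a u) == a.
  by rewrite size_takel// size_tuple leq_addr.
have dropP (u : (a + b).-tuple T) : size (drop a u) == b.
  by rewrite size_drop size_tuple addKn.
rewrite (reindex (fun st : a.-tuple T * b.-tuple T => cat_tuple st.1 st.2))//=.
exists (fun u => (Tuple (takeP u), Tuple (dropP u))) => [[s t] _|u _].
  congr pair; apply: val_inj => /=.
    by rewrite take_size_cat// size_tuple.
  by rewrite drop_size_cat// size_tuple.
by apply: val_inj; rewrite /= cat_take_drop.
Qed.

(** The q consecutive blocks of length p vary independently, so this is distributivity; induction
    splits off the first block. *)
Lemma sum_prod_blocks q p (h : 'I_q -> seq T -> R) :
  \sum_(u : (q * p).-tuple T) \prod_(j < q) h j (take p (drop (j * p) u)) =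
  \prod_(j < q) \sum_(t : p.-tuple T) h j t.
Proof.
elim: q h => [|q IH] h.
  rewrite big_ord0 (big_pred1 [tuple]) => [|u]; first by rewrite big_ord0.
  by apply/esym/eqP/val_inj; exact: size0nil (size_tuple u).
rewrite big_ord_recl -(IH (fun j => h (lift ord0 j))) mulr_suml.
rewrite (@sum_cat_tuple p (q * p)
  (fun u => \prod_(j < q.+1) h j (take p (drop (j * p) u)))).
apply: eq_bigr => s _; rewrite mulr_sumr; apply: eq_bigr => t _.
rewrite big_ord_recl/= mul0n drop0 take_size_cat ?size_tuple//; congr (_ * _).
apply: eq_bigr => j _; congr (h _ (take _ _)).
by rewrite /= /bump leq0n add1n mulSn addnC -drop_drop drop_size_cat// size_tuple.
Qed.

Lemma prod_blocks q p (g : T -> R) (u : seq T) : size u = (q * p)%N ->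
  \prod_(k <- u) g k = \prod_(j < q) \prod_(k <- take p (drop (j * p) u)) g k.
Proof.
elim: q u => [|q IH] u su.
  by rewrite big_ord0 (size0nil su) big_nil.
rewrite big_ord_recl/= mul0n drop0 -{1}(cat_take_drop p u) big_cat/=.
congr (_ * _); rewrite (IH (drop p u)); last by rewrite size_drop su mulSn addKn.
by apply: eq_bigr => j _; rewrite drop_drop /bump leq0n add1n mulSn addnC.
Qed.

Lemma sum_prod_tuple q (c : T -> R) :
  \sum_(s : q.-tuple T) \prod_(j < q) c (tnth s j) = (\sum_i c i) ^+ q.
Proof.
have -> : (\sum_i c i) ^+ q = \prod_(j < q) \sum_i c i.
  by rewrite prodr_const card_ord.
rewrite bigA_distr_bigA/=.
rewrite (reindex (fun f : {ffun 'I_q -> T} => [tuple f j | j < q]))/=.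
  by apply: eq_bigr => f _; apply: eq_bigr => j _; rewrite tnth_mktuple.
exists (fun s => [ffun j => tnth s j]) => [f _|s _].
  by apply/ffunP => j; rewrite ffunE tnth_mktuple.
by apply: eq_from_tnth => j; rewrite tnth_mktuple ffunE.
Qed.

(** After exchanging the sums, each v is counted once per rearrangement, which cancels the division
    by the class size. *)
Lemma sum_perm_average d (H m : d.-tuple T -> R) :
  (forall u v : d.-tuple T, perm_eq u v -> m u = m v) ->
  \sum_(u : d.-tuple T) (\sum_(v : d.-tuple T | perm_eq v u) H v)
    / #|[pred v : d.-tuple T | perm_eq v u]|%:R * m u = \sum_u H u * m u.
Proof.
move=> msym; pose N (u : d.-tuple T) := #|[pred v : d.-tuple T | perm_eq v u]|.
have NE (u v : d.-tuple T) : perm_eq u v -> N u = N v.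
  by move=> /permPr uv; apply: eq_card => w; rewrite !inE uv.
transitivity (\sum_(u : d.-tuple T) \sum_(v : d.-tuple T | perm_eq v u)
    H v * m v / (N v)%:R).
  apply: eq_bigr => u _; rewrite 2!mulr_suml; apply: eq_bigr => v vu.
  by rewrite (msym _ _ vu) (NE _ _ vu) mulrAC.
rewrite (exchange_big_dep predT)//=; apply: eq_bigr => v _.
rewrite (eq_bigl (fun u => u \in [pred u : d.-tuple T | perm_eq u v])); last first.
  by move=> u; rewrite inE perm_sym.
rewrite sumr_const -/(N v) -[LHS]mulr_natr divfK// pnatr_eq0.
by apply/eqP => /card0_eq/(_ v); rewrite !inE perm_refl.
Qed.

End Blocks.

Section Composition.
Variables (R : realType) (n : nat).
Implicit Types (F G : tensor R n) (x : 'I_n -> R).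

Lemma tsym_symz d F : tsym d (symz d F).
Proof.
move=> i s t /permPr st; rewrite /symz; congr (_ / _%:R).
  by apply: eq_bigl => v; rewrite st.
by apply: eq_card => v; rewrite !inE st.
Qed.

Lemma polymap_symz d F : polymap d (symz d F) = polymap d F.
Proof.
apply/funext => x; apply/funext => i.
apply: (@sum_perm_average R _ d (F i) (fun u => \prod_(j <- u) x j)) => u v uv.
exact: perm_big.
Qed.

Lemma tsym_tcomp q p G F : tsym (q * p) (tcomp q p G F).
Proof. exact: tsym_symz. Qed.

(** Symmetrization keeps the map. The monomial in u splits along the blocks, and the sum over u
    factors into coordinates of F(x). *)
Lemma polymap_tcomp q p G F x :
  polymap (q * p) (tcomp q p G F) x = polymap q G (polymap p F x).
Proof.
rewrite polymap_symz; apply/funext => i.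
transitivity (\sum_(s : q.-tuple 'I_n) G i s * \sum_(u : (q * p).-tuple 'I_n)
    \prod_(j < q) (F (tnth s j) (take p (drop (j * p) u)) *
      \prod_(k <- take p (drop (j * p) u)) x k)).
  under [RHS]eq_bigr do rewrite mulr_sumr.
  rewrite exchange_big/=; apply: eq_bigr => u _; rewrite mulr_suml.
  apply: eq_bigr => s _; rewrite big_split/= -mulrA; congr (_ * (_ * _)).
  by apply: prod_blocks; rewrite size_tuple.
apply: eq_bigr => s _; congr (_ * _).
rewrite (sum_prod_blocks p (fun j b => F (tnth s j) b * \prod_(k <- b) x k)).
by rewrite big_tuple.
Qed.

Lemma hsnorm_ge0 d F : 0 <= hsnorm d F.
Proof. exact: sqrtr_ge0. Qed.

Lemma sqr_hsnorm d F :
  hsnorm d F ^+ 2 = \sum_(i < n) \sum_(t : d.-tuple 'I_n) F i t ^+ 2.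
Proof.
rewrite sqr_sqrtr//; apply: sumr_ge0 => i _; apply: sumr_ge0 => t _.
exact: sqr_ge0.
Qed.

(** Cauchy-Schwarz against the constant 1 bounds a squared average by the average of the squares;
    [sum_perm_average] with weight 1 adds these up. *)
Lemma hsnorm_symz d F : hsnorm d (symz d F) <= hsnorm d F.
Proof.
apply: ler_wsqrtr; apply: ler_sum => i _.
have := @sum_perm_average R _ d (fun u => F i u ^+ 2) (fun=> 1) (fun _ _ _ => erefl).
under [X in _ = X]eq_bigr do rewrite mulr1.
move=> <-; apply: ler_sum => u _; rewrite mulr1 /symz.
set P := fun v : d.-tuple 'I_n => perm_eq v u.
pose N := #|[pred v : d.-tuple 'I_n | perm_eq v u]|; rewrite -/N; have N0 : 0 < N%:R :> R.
  by rewrite ltr0n; apply/card_gt0P; exists u; rewrite inE perm_refl.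
have NE : N%:R = \sum_(v | P v) (1 : R) by rewrite sumr_const.
have : (\sum_(v | P v) F i v) ^+ 2 <= (\sum_(v | P v) F i v ^+ 2) * N%:R.
  rewrite NE !(big_mkcond P)/=.
  have := cauchy_schwarz (fun v => if P v then F i v else 0)
    (fun v => if P v then 1 else 0).
  by congr (_ ^+ 2 <= _ * _); apply: eq_bigr => v _; case: (P v);
    rewrite ?mulr1 ?mul0r ?expr0n ?expr1n.
by rewrite expr_div_n ler_pdivrMr ?exprn_gt0// expr2 mulrA divfK ?gt_eqF.
Qed.

(** Cauchy-Schwarz over [s] separates the entries of G from the products of entries of F, whose
    squares sum blockwise to the norm of F to the power 2q. *)
Lemma hsnorm_tcomp q p G F :
  hsnorm (q * p) (tcomp q p G F) <= hsnorm q G * hsnorm p F ^+ q.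
Proof.
apply: le_trans (hsnorm_symz _ _) _.
rewrite -(@ler_pXn2r _ 2) ?nnegrE ?mulr_ge0 ?exprn_ge0 ?hsnorm_ge0//.
rewrite exprMn exprAC !sqr_hsnorm mulr_suml; apply: ler_sum => i _.
apply: le_trans (_ : \sum_(u : (q * p).-tuple 'I_n)
    (\sum_(s : q.-tuple 'I_n) G i s ^+ 2) *
    (\sum_(s : q.-tuple 'I_n)
      \prod_(j < q) F (tnth s j) (take p (drop (j * p) u)) ^+ 2) <= _).
  apply: ler_sum => u _; apply: le_trans (cauchy_schwarz _ _) _.
  by under [X in _ * X <= _]eq_bigr do rewrite -prodrXl.
rewrite -mulr_sumr exchange_big/= -sum_prod_tuple.
rewrite le_eqVlt; apply/orP; left; apply/eqP; congr (_ * _).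
apply: eq_bigr => s _.
exact: (sum_prod_blocks p (fun j b => F (tnth s j) b ^+ 2)).
Qed.

(** At a maximizing unit x, Cauchy-Schwarz applies to each coordinate of F(x); the squared monomials
    sum to |x|^(2d) = 1. *)
Lemma specnorm_le_hsnorm d F : (0 < n)%N -> tsym d F ->
  specnorm d F <= hsnorm d F.
Proof.
move=> n0 Fs; have [x x1 ->] := specnorm_attained n0 Fs.
apply: ler_wsqrtr; apply: ler_sum => i _.
apply: le_trans (cauchy_schwarz _ _) _.
under [X in _ * X <= _]eq_bigr do rewrite big_tuple -prodrXl.
by rewrite (sum_prod_tuple d (fun k => x k ^+ 2)) -dotE x1 expr1n mulr1.
Qed.

End Composition.

(** * Convergence of root sequences *)

Section RootSequences.
Variables (R : realType) (p : nat).
Hypothesis p_ge2 : (2 <= p)%N.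

(** This is (p^k - 1) / (p - 1), the inverse of the normalizing exponent. *)
Definition geo (k : nat) : nat := \sum_(i < k) p ^ i.

Lemma expn_geo k : (p ^ k = (p - 1) * geo k + 1)%N.
Proof.
have := predn_exp p k; rewrite -!subn1 -/(geo k) => <-.
by rewrite subnK// expn_gt0 (leq_trans _ p_ge2).
Qed.

(** At k = 0 both sides are 0, the inverse of 0 being 0. *)
Lemma exponent_geo k : (p - 1)%:R / (p ^ k - 1)%:R = (geo k)%:R^-1 :> R.
Proof.
rewrite expn_geo addnK natrM invfM mulrA mulfV ?mul1r// pnatr_eq0.
by rewrite -lt0n subn_gt0.
Qed.

Lemma geo1 : geo 1 = 1%N.
Proof. by rewrite /geo big_ord1 expn0. Qed.

Lemma geoD k l : geo (k + l) = (geo k + p ^ k * geo l)%N.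
Proof.
rewrite /geo big_split_ord/=; congr addn; rewrite big_distrr/=.
by apply: eq_bigr => i _; rewrite expnD.
Qed.

Lemma geoS k : geo k.+1 = (1 + p * geo k)%N.
Proof. by rewrite -add1n geoD geo1 expn1. Qed.

Lemma leq_geo k : (k <= geo k)%N.
Proof.
elim: k => // k IH; rewrite geoS add1n ltnS; apply: leq_trans IH _.
by rewrite leq_pmull// (leq_trans _ p_ge2).
Qed.

Lemma powR_exprnK (x : R) m : 0 <= x -> (0 < m)%N -> (x ^+ m) `^ (m%:R^-1) = x.
Proof.
move=> x0 m0; rewrite -powR_mulrn// -powRrM mulfV ?powRr1//.
by rewrite pnatr_eq0 -lt0n.
Qed.

Lemma powR_le_mono (x y r : R) : 0 <= r -> 0 <= x -> x <= y -> x `^ r <= y `^ r.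
Proof.
move=> r0 x0 xy; apply: ge0_ler_powR => //; rewrite nnegrE//.
exact: le_trans xy.
Qed.

Variable A : nat -> R.
Hypothesis A_ge0 : forall k, 0 <= A k.
Hypothesis A1_gt0 : 0 < A 1.
Hypothesis A_sub : forall l, (0 < l)%N -> A l.+1 <= A 1 * A l ^+ p.

(* [B l = A l / A 1 ^ geo l] satisfies [B l.+1 <= (B l)^p] and [B 1 = 1], so
   [z l = B l ^ (1 / p^l)] is nonincreasing, and the normalized sequence is
   [z l ^ (p - 1 + 1 / geo l)]. *)
Lemma cvg_root_seq : cvgn (fun k => A k `^ ((p - 1)%:R / (p ^ k - 1)%:R)).
Proof.
have p0 : (0 < p)%N by exact: leq_trans p_ge2.
pose B l := A l / A 1 ^+ geo l.
have B0 l : 0 <= B l by rewrite divr_ge0// exprn_ge0.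
have BS l : B l.+2 <= B l.+1 ^+ p.
  rewrite /B expr_div_n -exprM ler_pdivrMr ?exprn_gt0//.
  rewrite [geo l.+2]geoS (mulnC p) exprD expr1 mulrCA.
  by rewrite divfK ?A_sub// expf_neq0// gt_eqF.
have B1 l : B l.+1 <= 1.
  elim: l => [|l IH]; first by rewrite /B geo1 expr1 divff// gt_eqF.
  by apply: le_trans (BS l) _; rewrite exprn_ile1.
(* The index is shifted so that only positive indices of [A] occur, those covered by [A_sub]. *)
pose z l := B l.+1 `^ ((p ^ l.+1)%:R^-1).
have z0 l : 0 <= z l by exact: powR_ge0.
have z1 l : z l <= 1.
  have -> : 1 = 1 `^ ((p ^ l.+1)%:R^-1) :> R by rewrite powR1.
  by rewrite powR_le_mono// invr_ge0.
have zS l : z l.+1 <= z l.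
  apply: le_trans (_ : (B l.+1 ^+ p) `^ ((p ^ l.+2)%:R^-1) <= _).
    by apply: powR_le_mono => //; rewrite invr_ge0.
  rewrite -powR_mulrn// -powRrM expnS natrM invfM mulrA mulfV ?mul1r//.
  by rewrite pnatr_eq0 -lt0n.
have zn : nonincreasing_seq z by apply/nonincreasing_seqP.
have zlb : has_lbound (range z) by exists 0 => _ [l _ <-].
have cz := nonincreasing_is_cvgn zn zlb.
set zeta := limn z; have zetaz l : zeta <= z l by exact: nonincreasing_cvgn_ge.
have zeta0 : 0 <= zeta by apply: limr_ge => //; exact: nearW.
(* This is p^(l+1) / geo (l+1), which converts the root of order p^(l+1) into the one of order geo
   (l+1). *)
pose e l : R := (p - 1)%:R + (geo l.+1)%:R^-1.
have e0 l : (p - 1)%:R <= e l by rewrite lerDl invr_ge0.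
have p1 : 0 < (p - 1)%:R :> R by rewrite ltr0n subn_gt0.
have ze l : z l `^ e l = B l.+1 `^ ((geo l.+1)%:R^-1).
  rewrite -powRrM; congr powR.
  have g0 : (geo l.+1)%:R != 0 :> R by rewrite pnatr_eq0 -lt0n (leq_trans _ (leq_geo _)).
  rewrite /e expn_geo natrD natrM.
  have h : (p - 1)%:R * (geo l.+1)%:R + 1 != 0 :> R.
    by rewrite gt_eqF// ltr_pwDr// mulr_ge0.
  by field; rewrite h g0.
(* As 0 <= zeta <= z l <= 1 and e l >= p - 1, the terms lie between zeta^(e l) and (z l)^(p - 1).
   The case zeta = 0 is separate because the lower bound is handled through ln zeta. *)
have cv : (fun l => z l `^ e l) @ \oo --> zeta ^+ (p - 1).
  have up l : z l `^ e l <= z l ^+ (p - 1).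
    rewrite -powR_mulrn//; have [zl0|zl0] := eqVneq (z l) 0.
      by rewrite zl0 powR0 ?powR_ge0// gt_eqF// (lt_le_trans p1).
    by apply: ger_powR => //; rewrite lt_neqAle eq_sym zl0 z0 z1.
  have cup : (fun l => z l ^+ (p - 1)) @ \oo --> zeta ^+ (p - 1).
    apply: (@cvg_comp _ _ _ z (fun x : R => x ^+ (p - 1)) _ _ _ cz).
    exact: exprn_continuous.
  have [zeta00|zeta_neq0] := eqVneq zeta 0.
    apply: (@squeeze_cvgr _ _ _ _ (cst 0) (fun l => z l ^+ (p - 1))) => //.
      by apply: nearW => l; rewrite powR_ge0 up.
    rewrite zeta00 expr0n eqn0Ngt subn_gt0 p_ge2; exact: cvg_cst.
  apply: (@squeeze_cvgr _ _ _ _ (fun l => zeta `^ e l) (fun l => z l ^+ (p - 1))) => //.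
    apply: nearW => l; rewrite up andbT powR_le_mono//.
    exact: le_trans (ltW p1) (e0 l).
  have ce : e @ \oo --> ((p - 1)%:R : R).
    rewrite -[X in _ --> X]addr0; apply: cvgD; first exact: cvg_cst.
    apply: (@squeeze_cvgr _ _ _ _ (cst 0) (@harmonic R)); last 2 first.
    - exact: cvg_cst.
    - exact: cvg_harmonic.
    apply: nearW => l; rewrite /= invr_ge0 ler0n/=.
    by rewrite lef_pV2 ?posrE ?ltr0n ?(leq_trans _ (leq_geo _))// ler_nat leq_geo.
  rewrite -powR_mulrn// /powR (negbTE zeta_neq0).
  apply: (@cvg_comp _ _ _ (fun l => e l * ln zeta) (@expR R));
    last exact: continuous_expR.
  by apply: cvgM => //; exact: cvg_cst.
apply/cvg_ex; exists (A 1 * zeta ^+ (p - 1)); rewrite -cvg_shiftS.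
have -> : [sequence A n.+1 `^ ((p - 1)%:R / (p ^ n.+1 - 1)%:R)]_n =
    (fun l => A 1 * (z l `^ e l)).
  apply/funext => l /=; rewrite exponent_geo ze.
  have -> : A l.+1 = A 1 ^+ geo l.+1 * B l.+1.
    by rewrite /B mulrC divfK// expf_neq0// gt_eqF.
  rewrite powRM ?exprn_ge0// powR_exprnK//.
  exact: leq_trans (leq_geo _).
by apply: cvgM; [exact: cvg_cst|exact: cv].
Qed.

End RootSequences.

(** * Iterates *)

Section Iterates.
Variables (R : realType) (n p : nat) (F : tensor R n).
Hypothesis p_ge2 : (2 <= p)%N.
Hypothesis F_sym : tsym p F.

Lemma polymap_titer k : polymap (p ^ k) (titer p F k) = iter k (polymap p F).
Proof.
elim: k => [|k IH].
  apply/funext => x; apply/funext => i.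
  rewrite expn0 /polymap (bigD1 [tuple i])//= /tid eqxx mul1r big_seq1 big1 ?addr0//.
  by move=> t ti; rewrite ifN ?mul0r.
rewrite expnSr; apply/funext => x.
(* The recursion of [titer] applies the new factor F first, hence [iterSr]. *)
by rewrite [titer _ _ _]/= polymap_tcomp IH iterSr.
Qed.

Lemma tsym_titer k : tsym (p ^ k) (titer p F k).
Proof.
case: k => [i s t /perm_small_eq st|k]; last by rewrite expnSr; exact: tsym_tcomp.
by rewrite st// size_tuple.
Qed.
Arguments tsym_titer : clear implicits.

(** Both sides are symmetric with the same map. Equality of entries is what the Hilbert-Schmidt norm
    requires. *)
Lemma titerD k l :
  teq (p ^ (k + l)) (titer p F (k + l))
    (tcomp (p ^ k) (p ^ l) (titer p F k) (titer p F l)).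
Proof.
rewrite expnD; apply: polymap_inj.
- by rewrite -expnD; exact: tsym_titer.
- exact: tsym_tcomp.
apply/funext => x; rewrite polymap_tcomp -expnD !polymap_titer.
by rewrite iterD.
Qed.
Arguments titerD : clear implicits.

Lemma titer1 : teq p (titer p F 1) F.
Proof.
have := tsym_titer 1; have := @polymap_titer 1; rewrite expn1 => h1 h2.
exact: polymap_inj.
Qed.

Hypothesis n_gt0 : (0 < n)%N.

Let sigma k := specnorm (p ^ k) (titer p F k).

Lemma sigma_ge0 k : 0 <= sigma k.
Proof. exact: specnorm_ge0 n_gt0 (tsym_titer k). Qed.

Lemma sigma1 : sigma 1 = specnorm p F.
Proof. by rewrite /sigma expn1; apply: eq_specnorm; exact: titer1. Qed.

Lemma specnorm_titerD k l : sigma (k + l) <= sigma k * sigma l ^+ (p ^ k).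
Proof.
have [x x1 xkl] := specnorm_attained n_gt0 (tsym_titer (k + l)).
rewrite [sigma (k + l)]xkl polymap_titer iterD -!polymap_titer.
apply: le_trans (norm2_polymap_le _ n_gt0 (tsym_titer k)) _.
rewrite ler_wpM2l ?sigma_ge0// lerXn2r ?nnegrE ?norm2_ge0 ?sigma_ge0//.
apply: le_trans (norm2_polymap_le _ n_gt0 (tsym_titer l)) _.
by have /norm2_eq1 -> := x1; rewrite expr1n mulr1.
Qed.

Lemma specnorm_titerD_eq k l :
  sigma (k + l) = sigma k * sigma l ^+ (p ^ k) <->
  (tzero (p ^ l) (titer p F l) \/
   exists x : 'I_n -> R, norm2 x = 1 /\
     norm2 (polymap (p ^ l) (titer p F l) x) = sigma l /\
     norm2 (polymap (p ^ k) (titer p F k)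
              (fun i => (sigma l)^-1 * polymap (p ^ l) (titer p F l) x i))
       = sigma k).
Proof.
have pk0 : (0 < p ^ k)%N by rewrite expn_gt0 (leq_trans _ p_ge2).
have sigma_l0 : sigma l = 0 -> sigma (k + l) = sigma k * sigma l ^+ (p ^ k).
  move=> l0; rewrite l0 expr0n eqn0Ngt pk0 mulr0.
  apply/eqP; rewrite eq_le sigma_ge0 andbT.
  apply: le_trans (specnorm_titerD _ _) _.
  by rewrite l0 expr0n eqn0Ngt pk0 mulr0.
(* By homogeneity, normalizing F^l(x) divides |F^(k+l)(x)| by the power p^k of [sigma l]. *)
have normZ x : norm2 (polymap (p ^ k) (titer p F k)
      (fun i => (sigma l)^-1 * polymap (p ^ l) (titer p F l) x i)) =
    norm2 (polymap (p ^ (k + l)) (titer p F (k + l)) x) / sigma l ^+ (p ^ k).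
  rewrite (polymap_titer (k + l)) iterD -!polymap_titer.
  have -> : polymap (p ^ k) (titer p F k)
      (fun i => (sigma l)^-1 * polymap (p ^ l) (titer p F l) x i) =
      (fun i => (sigma l)^-1 ^+ (p ^ k) *
        polymap (p ^ k) (titer p F k) (polymap (p ^ l) (titer p F l) x) i).
    by apply/funext => i; rewrite polymapZ.
  by rewrite norm2Z ?exprn_ge0 ?invr_ge0 ?sigma_ge0// mulrC exprVn.
split=> [eqD|[F0|[x [x1 [xl xk]]]]]; last 2 first.
- by apply: sigma_l0; exact: tzero_specnorm0 n_gt0 (tsym_titer l) F0.
- have [/sigma_l0//|l0] := eqVneq (sigma l) 0.
  (* The witness turns the right-hand side into |F^(k+l)(x)|, at most [sigma (k + l)]. *)
  apply/eqP; rewrite eq_le specnorm_titerD/= -xk normZ divfK ?expf_neq0//.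
  have := norm2_polymap_le x n_gt0 (tsym_titer (k + l)).
  by rewrite x1 expr1n mulr1.
have [l0|l0] := eqVneq (sigma l) 0.
  by left; exact: specnorm0_tzero (tsym_titer l) l0.
have lgt0 : 0 < sigma l by rewrite lt_neqAle eq_sym l0 sigma_ge0.
(* If [sigma k] is 0, so is [sigma (k + l)], and any unit maximizer for F^l serves. *)
right; have [k0|k0] := eqVneq (sigma k) 0.
  have [x x1 xl] := specnorm_attained n_gt0 (tsym_titer l).
  exists x; split; first exact/norm2_eq1.
  split=> //; rewrite normZ.
  apply/eqP; rewrite eq_le k0 divr_ge0 ?norm2_ge0 ?exprn_ge0 ?sigma_ge0// andbT.
  rewrite pmulr_lle0 ?invr_gt0 ?exprn_gt0//.
  have := norm2_polymap_le x n_gt0 (tsym_titer (k + l)).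
  by have /norm2_eq1 -> := x1; rewrite expr1n mulr1 -/(sigma _) eqD k0 mul0r.
have [x x1 xkl] := specnorm_attained n_gt0 (tsym_titer (k + l)).
have kgt0 : 0 < sigma k by rewrite lt_neqAle eq_sym k0 sigma_ge0.
(* A maximizer for F^(k+l) must saturate both bounds: cancelling [sigma k] and the power p^k leaves
   |F^l(x)| >= [sigma l]. *)
exists x; split; first exact/norm2_eq1; split; last first.
  by rewrite normZ -xkl -/(sigma _) eqD mulfK// expf_neq0.
apply/eqP; rewrite eq_le; apply/andP; split.
  have := norm2_polymap_le x n_gt0 (tsym_titer l).
  by have /norm2_eq1 -> := x1; rewrite expr1n mulr1.
rewrite -(@ler_pXn2r _ (p ^ k)) ?nnegrE ?norm2_ge0 ?sigma_ge0//.
rewrite -(@ler_pM2l _ (sigma k))// -eqD /sigma xkl.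
rewrite (polymap_titer (k + l)) iterD -!polymap_titer.
exact: norm2_polymap_le n_gt0 (tsym_titer k).
Qed.

Lemma ftildeE k : ftilde p F k = sigma k `^ ((geo p k)%:R^-1).
Proof. by rewrite /ftilde exponent_geo. Qed.

Lemma specnorm_titer_geo k : (0 < k)%N -> sigma k <= sigma 1 ^+ geo p k.
Proof.
case: k => // k _; elim: k => [|k IH]; first by rewrite geo1 expr1.
rewrite -[k.+2]add1n; apply: le_trans (specnorm_titerD _ _) _.
rewrite geoD geo1 exprD expr1 ler_wpM2l ?sigma_ge0//.
by rewrite mulnC exprM lerXn2r ?nnegrE ?exprn_ge0 ?sigma_ge0.
Qed.

Lemma geo_gt0 k : (0 < k)%N -> (0 < geo p k)%N.
Proof. by move=> /leq_trans; apply; exact: leq_geo. Qed.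

Lemma ftilde_le k : (0 < k)%N -> ftilde p F k <= specnorm p F.
Proof.
move=> k0; rewrite ftildeE -sigma1.
rewrite -[leRHS](@powR_exprnK _ _ (geo p k)) ?sigma_ge0 ?geo_gt0//.
by apply: powR_le_mono; rewrite ?invr_ge0 ?sigma_ge0 ?specnorm_titer_geo.
Qed.

(** With k = l the bound is sigma_k^(p^k + 1), and geo (2k) = (p^k + 1) geo k matches the roots. *)
Lemma ftilde_double k : (0 < k)%N -> ftilde p F (k + k) <= ftilde p F k.
Proof.
move=> k0; rewrite !ftildeE.
apply: le_trans (powR_le_mono _ _ (specnorm_titerD k k)) _;
  rewrite ?invr_ge0 ?sigma_ge0//.
rewrite -exprS -powR_mulrn ?sigma_ge0// -powRrM.
suff -> : (p ^ k).+1%:R * (geo p (k + k))%:R^-1 = (geo p k)%:R^-1 :> R by [].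
have -> : geo p (k + k) = ((p ^ k).+1 * geo p k)%N by rewrite geoD mulSn.
by rewrite natrM invfM mulrA mulfV ?mul1r// pnatr_eq0.
Qed.

Lemma ftilde_dyadic m : (0 < m)%N -> forall l1 l2 : nat, (l1 <= l2)%N ->
  ftilde p F (m * 2 ^ l2) <= ftilde p F (m * 2 ^ l1).
Proof.
move=> m0 l1 l2 /subnK <-; elim: (l2 - l1)%N => // l IH.
apply: le_trans IH; rewrite addSn expnS mulnCA mul2n -addnn.
by apply: ftilde_double; rewrite muln_gt0 m0 expn_gt0.
Qed.

Hypothesis F_neq0 : ~ tzero p F.

Lemma sigma1_gt0 : 0 < sigma 1.
Proof.
rewrite lt_neqAle sigma_ge0 andbT eq_sym; apply/eqP; rewrite sigma1 => F0.
by apply: F_neq0; exact: specnorm0_tzero.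
Qed.

Lemma ftilde_cvg : cvgn (ftilde p F).
Proof.
apply: (cvg_root_seq p_ge2 sigma_ge0 sigma1_gt0) => l _.
by have := specnorm_titerD 1 l; rewrite expn1.
Qed.

(** [titerD] puts F on the outside, as the recursive bound requires; positivity comes from the
    spectral norm. *)
Lemma hsnorm_titer_cvg : cvgn (fun k =>
  hsnorm (p ^ k) (titer p F k) `^ ((p - 1)%:R / (p ^ k - 1)%:R)).
Proof.
apply: (cvg_root_seq p_ge2 (A := fun k => hsnorm (p ^ k) (titer p F k))).
- by move=> k; exact: hsnorm_ge0.
- apply: lt_le_trans sigma1_gt0 _.
  exact: specnorm_le_hsnorm n_gt0 (tsym_titer 1).
move=> l _; rewrite (eq_hsnorm (titerD 1 l)) expnD.
by apply: le_trans (hsnorm_tcomp _ _ _ _) _; rewrite expn1.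
Qed.

(** Both convergences are needed to pass the termwise comparison to the values of [limn]. *)
Lemma lim_ftilde_le : limn (ftilde p F) <= rho2 p F.
Proof.
apply: ler_lim; [exact: ftilde_cvg|exact: hsnorm_titer_cvg|].
apply: nearW => k; apply: powR_le_mono; rewrite ?divr_ge0 ?sigma_ge0//.
exact: specnorm_le_hsnorm n_gt0 (tsym_titer k).
Qed.

End Iterates.

Theorem theorem3p3 (R : realType) (n p : nat) (F : tensor R n) :
  (2 <= p)%N ->
  tsym p F ->
  ~ tzero p F ->
  ~ (exists (a : R) (u : 'I_n -> R), a != 0 /\ norm2 u = 1 /\
       forall (i : 'I_n) (t : p.-tuple 'I_n), F i t = a * u i * \prod_(j <- t) u j) ->
  [/\ (forall k : nat, (0 < k)%N -> ftilde p F k <= specnorm p F),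
      (forall k l : nat, (0 < k)%N -> (0 < l)%N ->
         specnorm (p ^ (k + l)) (titer p F (k + l))
         <= specnorm (p ^ k) (titer p F k) * specnorm (p ^ l) (titer p F l) ^+ (p ^ k)),
      (forall m : nat, (0 < m)%N -> forall l1 l2 : nat, (l1 <= l2)%N ->
         ftilde p F (m * 2 ^ l2) <= ftilde p F (m * 2 ^ l1)),
      cvgn (ftilde p F) /\ limn (ftilde p F) <= rho2 p F
    & forall k l : nat, (0 < k)%N -> (0 < l)%N ->
      (specnorm (p ^ (k + l)) (titer p F (k + l))
         = specnorm (p ^ k) (titer p F k) * specnorm (p ^ l) (titer p F l) ^+ (p ^ k)
       <->
       (tzero (p ^ l) (titer p F l) \/
        exists x : 'I_n -> R, norm2 x = 1 /\
          norm2 (polymap (p ^ l) (titer p F l) x) = specnorm (p ^ l) (titer p F l) /\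
          norm2 (polymap (p ^ k) (titer p F k)
                   (fun i => (specnorm (p ^ l) (titer p F l))^-1
                             * polymap (p ^ l) (titer p F l) x i))
            = specnorm (p ^ k) (titer p F k)))].
Proof.
move=> p2 Fs F0 _.
(* In dimension 0 every tensor is vacuously zero. *)
have n0 : (0 < n)%N.
  rewrite lt0n; apply/eqP => n0; apply: F0 => i.
  by have := ltn_ord i; rewrite [X in (_ < X)%N]n0.
split.
- exact: ftilde_le.
- by move=> k l _ _; exact: specnorm_titerD.
- exact: ftilde_dyadic.
- by split; [exact: ftilde_cvg|exact: lim_ftilde_le].
- by move=> k l _ _; exact: specnorm_titerD_eq.
Qed.
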